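(* For every sufficiently large positive integer $n$ there is a graph $G$ on $n$ vertices that is the (edge-)disjoint union of two comparability graphs on the vertex set $V(G)$, such that the largest homogeneous set of $G$ has size $\left\lceil n^{1/3}\left(\frac{\log n}{\log\log n}\right)^{2/3}\right\rceil$.
   Context: Graphs are finite and simple. A graph $G_0$ is a comparability graph if there is a partial order on its vertex set $V(G_0)$ such that two distinct vertices are adjacent in $G_0$ if and only if they are comparable in the partial order. $G$ is the disjoint union of two comparability graphs $G_1,G_2$ if $V(G_1)=V(G_2)=V(G)$, $E(G)=E(G_1)\cup E(G_2)$ and $E(G_1)\cap E(G_2)=\emptyset$. A homogeneous set of $G$ is a set of vertices that is a clique or an independent set of $G$. $\log$ is the natural logarithm. *)

(* Defs.v *)
From mathcomp Require Import all_boot all_order all_algebra.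
From mathcomp Require Import reals exp.

Set Implicit Arguments.
Unset Strict Implicit.
Unset Printing Implicit Defensive.

Record sgraph (T : finType) := SGraph {
  edge :> rel T;
  edge_sym : symmetric edge;
  edge_irrefl : irreflexive edge }.

Definition partial_order (T : finType) (le : rel T) : Prop :=
  [/\ reflexive le, antisymmetric le & transitive le].

Definition comparability_graph (T : finType) (G : sgraph T) : Prop :=
  exists2 le : rel T, partial_order le &
    forall x y : T, x != y -> G x y = le x y || le y x.

Definition edge_disjoint_union (T : finType) (G G1 G2 : sgraph T) : Prop :=
  (forall x y : T, G x y = G1 x y || G2 x y) /\
  (forall x y : T, ~~ (G1 x y && G2 x y)).

Definition clique (T : finType) (G : sgraph T) (S : {set T}) : bool :=
  [forall x in S, forall y in S, (x != y) ==> G x y].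

Definition independent (T : finType) (G : sgraph T) (S : {set T}) : bool :=
  [forall x in S, forall y in S, ~~ G x y].

Definition homogeneous (T : finType) (G : sgraph T) (S : {set T}) : bool :=
  clique G S || independent G S.

Definition hom_number (T : finType) (G : sgraph T) : nat :=
  \max_(S : {set T} | homogeneous G S) #|S|.

(* Main.v *)
Require Import Defs.
From mathcomp Require Import all_boot all_order all_algebra.
From mathcomp Require Import reals sequences exp.
From mathcomp Require Import ring lra.

(** The graph lives on a [k] x [k] grid whose cells are copies of an abelian
    group [Z] of order [K].  Write a vertex as [(x, y, z)], with column [x] and
    row [y].  Two vertices that differ both in column and in row are always
    adjacent: through the first order if the later column has the higher row,
    through the second one if it has the lower row.  Two vertices in the same
    row but in different columns are adjacent, through the first order, when
    their last coordinates agree; two vertices in the same column but in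
    different rows are adjacent, through the second order, when their labels
    [z + s (x, y)] agree, where [s] is a matrix of shifts.  Vertices in the same
    cell are not adjacent.  Both relations are transitive, and no pair is
    comparable in both.

    An independent set must lie in one row or in one column, and is determined
    there by the last coordinates, respectively the labels, of its members, so
    it has at most [K] vertices ([grid_independent]).  A clique meets each cell
    at most once, each row [y] in a single last coordinate [f y], and each
    column [x] in a single label [g x]; so its size is at most the number of
    cells where [s (x, y) = g x - f y] ([grid_clique]).  For a random [s], given
    [f] and [g], this number is at least [K] with probability at most
    ['C(k ^ 2, K) / K ^ K], and there are [K ^ (2 * k)] pairs [(f, g)].  Hence
    some [s] works as soon as [K ^ (2 * k) * 'C(k ^ 2, K) < K ^ K]
    ([exists_grid_graph]).

    Let [t = ln n / ln (ln n)], let [K] be the ceiling of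
    [n ^ (1/3) * t ^ (2/3)], and let [k] be the integer part of [2 K / t].  Then
    [k ^ 2 * K >= n], because [K ^ 3 >= n * t ^ 2] and [k >= K / t].  The
    logarithm of [K ^ (2 * k)] is at most about [(4/3) K * ln (ln n)], while
    ['C(k ^ 2, K) / K ^ K] is at most [(e k ^ 2 / K ^ 2) ^ K], with logarithm
    about [- 2 K * ln (ln n)]; so the inequality above holds for large [n]
    ([parameters_ineq]).

    To have exactly [n] vertices and homogeneous number exactly [K], take an
    induced subgraph on [n] vertices and isolate its vertices one after the
    other: the homogeneous number ends at [n >= K] and increases by at most one
    at each step, so that it takes the value [K] ([exists_hom_number]). *)

Import Order.TTheory GRing.Theory Num.Theory.
Local Open Scope ring_scope.

Set Implicit Arguments.
Unset Strict Implicit.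
Unset Printing Implicit Defensive.

Local Open Scope nat_scope.

(** * Homogeneous sets *)

Lemma leq_hom_number (T : finType) (G : sgraph T) (m : nat) :
  (forall S, homogeneous G S -> #|S| <= m) -> hom_number G <= m.
Proof. by move=> le_m; apply/bigmax_leqP => S homS; apply: le_m. Qed.

Lemma homogeneous_leq_hom (T : finType) (G : sgraph T) (S : {set T}) :
  homogeneous G S -> #|S| <= hom_number G.
Proof. exact: (@leq_bigmax_cond _ _ (fun S : {set T} => #|S|)). Qed.

Lemma cliqueP (T : finType) (G : sgraph T) (S : {set T}) :
  reflect {in S &, forall x y, x != y -> G x y} (clique G S).
Proof.
apply: (iffP forall_inP) => [cS x y xS yS | cS x xS].
  by move/(_ x xS)/forall_inP: cS => /(_ y yS) /implyP.
by apply/forall_inP => y yS; apply/implyP; apply: cS.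
Qed.

Lemma independentP (T : finType) (G : sgraph T) (S : {set T}) :
  reflect {in S &, forall x y, ~~ G x y} (independent G S).
Proof.
apply: (iffP forall_inP) => [iS x y xS yS | iS x xS].
  by move/(_ x xS)/forall_inP: iS => /(_ y yS).
by apply/forall_inP => y yS; apply: iS.
Qed.

Arguments cliqueP {T G S}.
Arguments independentP {T G S}.

(** [G] is the edge-disjoint union of two comparability graphs. *)
Definition two_comparability (T : finType) (G : sgraph T) : Prop :=
  exists G1 G2 : sgraph T,
    [/\ comparability_graph G1, comparability_graph G2
      & edge_disjoint_union G G1 G2].

(** * Induced subgraphs with isolated vertices *)

Section Pullback.
Variables (T U : finType) (f : U -> T).
Hypothesis f_inj : injective f.

(** Adjacency in the pullback of [G] along [f], the vertices of [A] being
    isolated. *)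
Definition pull_rel (G : sgraph T) (A : {set U}) : rel U :=
  fun x y => [&& x \notin A, y \notin A & G (f x) (f y)].

Lemma pull_sym G A : symmetric (pull_rel G A).
Proof. by move=> x y; rewrite /pull_rel edge_sym andbCA. Qed.

Lemma pull_irrefl G A : irreflexive (pull_rel G A).
Proof. by move=> x; rewrite /pull_rel edge_irrefl !andbF. Qed.

(** The pullback of [G] along the injection [f], that is, an induced subgraph
    of [G] up to renaming, in which all the edges at vertices of [A] have been
    deleted. *)
Definition pull (G : sgraph T) (A : {set U}) : sgraph U :=
  SGraph (pull_sym G A) (pull_irrefl G A).

Lemma pull_comparability (G : sgraph T) A :
  comparability_graph G -> comparability_graph (pull G A).
Proof.
case=> le [le_refl le_anti le_trans] GE.
exists (fun x y => (x == y) || [&& x \notin A, y \notin A & le (f x) (f y)]).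
  split=> [x|x y|y x z]; first by rewrite eqxx.
  - case: (x =P y) => //= _; rewrite eq_sym; case: (x =P y) => //= _.
    case/andP=> /and3P[_ _ lexy] /and3P[_ _ leyx].
    by apply/f_inj/le_anti; rewrite lexy.
  - case/predU1P=> [-> //|/and3P[xA yA lexy]].
    case/predU1P=> [<-|/and3P[_ zA leyz]]; first by rewrite xA yA lexy orbT.
    by rewrite xA zA (le_trans _ _ _ lexy leyz) orbT.
move=> x y xy; rewrite /= /pull_rel [y == x]eq_sym (negbTE xy) /=.
rewrite GE; last by rewrite (inj_eq f_inj).
by case: (x \in A); case: (y \in A).
Qed.

Lemma pull_two_comparability (G : sgraph T) A :
  two_comparability G -> two_comparability (pull G A).
Proof.
case=> G1 [G2] [cG1 cG2 [GE G12]]; exists (pull G1 A), (pull G2 A).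
split; [exact: pull_comparability | exact: pull_comparability | split=> x y].
  by rewrite /= /pull_rel GE; case: (x \in A); case: (y \in A).
by rewrite /= /pull_rel; case: (x \in A); case: (y \in A); rewrite //= G12.
Qed.

Lemma hom_pull0 (G : sgraph T) : hom_number (pull G set0) <= hom_number G.
Proof.
apply: leq_hom_number => S homS.
rewrite -(card_imset S f_inj); apply: homogeneous_leq_hom.
case/orP: homS => homS; apply/orP; [left | right].
  apply/cliqueP => _ _ /imsetP[x xS ->] /imsetP[y yS ->].
  rewrite (inj_eq f_inj) => xy.
  by have /and3P[] := cliqueP homS x y xS yS xy.
apply/independentP => _ _ /imsetP[x xS ->] /imsetP[y yS ->].
by have := independentP homS x y xS yS; rewrite /= /pull_rel !inE.
Qed.

Lemma hom_pullT (G : sgraph T) : #|U| <= hom_number (pull G setT).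
Proof.
rewrite -cardsT; apply/homogeneous_leq_hom/orP; right.
by apply/independentP => x y _ _; rewrite /= /pull_rel inE.
Qed.

(** Isolating one more vertex leaves every homogeneous set that avoids it
    homogeneous. *)
Lemma hom_pullU1 (G : sgraph T) A v :
  hom_number (pull G (v |: A)) <= (hom_number (pull G A)).+1.
Proof.
apply: leq_hom_number => S homS.
rewrite (cardsD1 v S) -add1n; apply: leq_add; first by case: (v \in S).
apply: homogeneous_leq_hom.
have pullE x y : x \in S :\ v -> y \in S :\ v ->
    pull G (v |: A) x y = pull G A x y.
  by rewrite /= /pull_rel !inE => /andP[/negbTE-> _] /andP[/negbTE-> _].
case/orP: homS => homS; apply/orP; [left | right].
  apply/cliqueP => x y xS yS xy; rewrite -pullE //.
  by case/setD1P: xS yS => _ xS /setD1P[_ yS]; apply: (cliqueP homS).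
apply/independentP => x y xS yS; rewrite -pullE //.
by case/setD1P: xS yS => _ xS /setD1P[_ yS]; apply: (independentP homS).
Qed.

(** Isolating the vertices one at a time, the homogeneous number climbs from
    at most that of [G] to [#|U|] in steps of at most one. *)
Lemma exists_hom_number (G : sgraph T) (m : nat) :
  hom_number G <= m -> m <= #|U| -> two_comparability G ->
  exists2 H : sgraph U, two_comparability H & hom_number H = m.
Proof.
move=> homG mU GG.
(* The first [i] vertices of [U], in the order of its enumeration. *)
pose A i := [set x in take i (enum U)].
have AS i : (A i.+1 = A i) \/ (exists v, A i.+1 = v |: A i).
  have [le_i|lt_i] := leqP #|U| i.
    by left; rewrite /A !take_oversize // -cardE // ltnW.
  pose x0 := enum_val (Ordinal lt_i).
  right; exists (nth x0 (enum U) i); apply/setP => x.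
  by rewrite in_setU1 !in_set (take_nth x0) -?cardE // mem_rcons in_cons.
have ex_i : exists i, m <= hom_number (pull G (A i)).
  exists #|U|; have -> : A #|U| = setT.
    by apply/setP => x; rewrite !inE cardE take_size mem_enum.
  exact: leq_trans mU (hom_pullT G).
(* The least number of isolated vertices for which [m] is reached. *)
case: (ex_minnP ex_i) => i le_m min_i.
exists (pull G (A i)); first exact: pull_two_comparability.
apply/eqP; rewrite eqn_leq le_m andbT.
case: i le_m min_i => [|i] le_m min_i.
  have -> : A 0 = set0 by apply/setP => x; rewrite !inE take0.
  exact: leq_trans (hom_pull0 G) homG.
have lt_m : hom_number (pull G (A i)) < m.
  by rewrite ltnNge; apply/negP => /min_i; rewrite ltnn.
case: (AS i) => [-> |[v ->]]; first exact: ltnW.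
exact: leq_trans (hom_pullU1 G (A i) v) lt_m.
Qed.
End Pullback.

(** * Comparability graphs of strict orders, and unions of graphs *)

Section StrictOrder.
Variables (T : finType) (lt : rel T).
Hypotheses (lt_irr : irreflexive lt) (lt_trans : transitive lt).

Lemma sym_closure_sym : symmetric (fun x y => lt x y || lt y x).
Proof. by move=> x y; rewrite orbC. Qed.

Lemma sym_closure_irrefl : irreflexive (fun x y => lt x y || lt y x).
Proof. by move=> x; rewrite lt_irr. Qed.

(** The graph whose edges are the comparable pairs of the strict order [lt]. *)
Definition strict_graph : sgraph T := SGraph sym_closure_sym sym_closure_irrefl.

Lemma strict_graph_comparability : comparability_graph strict_graph.
Proof.
exists (fun x y => (x == y) || lt x y).
  split=> [x|x y|y x z]; first by rewrite eqxx.
  - case: (x =P y) => //= _; rewrite eq_sym; case: (x =P y) => //= _.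
    by case/andP=> lxy /(lt_trans lxy); rewrite lt_irr.
  - case/predU1P=> [-> //|lxy] /predU1P[<-|lyz]; first by rewrite lxy orbT.
    by rewrite (lt_trans lxy lyz) orbT.
by move=> x y xy; rewrite /= [y == x]eq_sym (negbTE xy).
Qed.
End StrictOrder.

Section Union.
Variables (T : finType) (G1 G2 : sgraph T).

Lemma union_sym : symmetric (fun x y => G1 x y || G2 x y).
Proof. by move=> x y; rewrite (edge_sym G1) (edge_sym G2). Qed.

Lemma union_irrefl : irreflexive (fun x y => G1 x y || G2 x y).
Proof. by move=> x; rewrite !edge_irrefl. Qed.

(** The graph whose edges are those of [G1] and those of [G2]. *)
Definition union_graph : sgraph T := SGraph union_sym union_irrefl.
End Union.

(** * Functions rarely agreeing with any of few given functions *)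

(** Functions agreeing with [h] on [D] are determined by their values outside
    [D], which are free. *)
Lemma card_ffun_agree (I Z : finType) (h : I -> Z) (D : {set I}) :
  #|[set s : {ffun I -> Z} | [forall x in D, s x == h x]]| = #|Z| ^ #|~: D|.
Proof.
pose F x : pred Z := if x \in D then pred1 (h x) else predT.
have -> : #|[set s : {ffun I -> Z} | [forall x in D, s x == h x]]| =
          #|family F|.
  apply: eq_card => s; rewrite inE; apply/forall_inP/familyP => sh x.
    by rewrite /F; case: ifP => // xD; rewrite inE sh.
  by move=> xD; have := sh x; rewrite /F xD.
rewrite card_family foldrE big_map big_enum /= (bigID (mem D)) /=.
rewrite big1 => [|x xD]; last by rewrite /F xD card1.
rewrite mul1n -prod_nat_const; apply: eq_big => x; first by rewrite inE.
by rewrite /F => /negbTE->.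
Qed.

(** Union bound: given a family of target functions [h p], if a uniformly
    random function has expected number of agreement patterns
    [#|F| * 'C(#|I|, r) / #|Z| ^ r] less than one, where a pattern is a target
    together with an [r]-set of points, then some function agrees with every
    target at fewer than [r] points. *)
Lemma exists_rarely_agreeing (I Z F : finType) (h : F -> I -> Z) (r : nat) :
  0 < #|Z| -> #|F| * 'C(#|I|, r) < #|Z| ^ r ->
  exists s : {ffun I -> Z}, forall p, #|[set x | s x == h p x]| < r.
Proof.
move=> Z_gt0 lt_r.
have [/existsP[s /forallP sP]|] :=
  boolP [exists s : {ffun I -> Z}, [forall p, #|[set x | s x == h p x]| < r]].
  by exists s.
rewrite negb_exists => /forallP all_bad; exfalso.
pose agree (pD : F * {set I}) :=
  [set s : {ffun I -> Z} | [forall x in pD.2, s x == h pD.1 x]].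
pose P := setX [set: F] [set D : {set I} | #|D| == r].
have cover : [set: {ffun I -> Z}] \subset \bigcup_(pD in P) agree pD.
  apply/subsetP => s _.
  have := all_bad s; rewrite negb_forall => /existsP[p]; rewrite -leqNgt.
  case/card_geqP=> D [uD szD subD].
  apply/bigcupP; exists (p, [set x in D]); rewrite !inE /=.
    by rewrite cardsE (card_uniqP uD) szD.
  by apply/forall_inP => x; rewrite inE => /subD; rewrite inE.
have union_bound : #|\bigcup_(pD in P) agree pD| <= \sum_(pD in P) #|agree pD|.
  elim/big_rec2: _ => [|pD n B _ leBn]; first by rewrite cards0.
  by apply: leq_trans (leq_card_setU _ _) _; rewrite leq_add2l.
have := leq_trans (subset_leq_card cover) union_bound.
rewrite cardsT card_ffun leqNgt => /negP; apply.
rewrite (eq_bigr (fun=> #|Z| ^ (#|I| - r))); last first.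
  case=> p D; rewrite !inE /= => /eqP <-.
  by rewrite card_ffun_agree cardsCs setCK.
rewrite sum_nat_const cardsX cardsT card_draws.
have [le_r|gt_r] := leqP r #|I|; last first.
  by rewrite bin_small // muln0 mul0n expn_gt0 Z_gt0.
by rewrite -[in leqRHS](subnKC le_r) expnD ltn_pmul2r // expn_gt0 Z_gt0.
Qed.

(** * The grid graph *)

Section Grid.
Variables (k : nat) (Z : finZmodType) (s : {ffun 'I_k * 'I_k -> Z}).

Local Notation V := ('I_k * 'I_k * Z)%type.

(** The label of a vertex, which governs adjacency inside a column. *)
Definition label (p : V) : Z := (p.2 + s p.1)%R.

(** First order: later column, and either a higher row, or the same row and the
    same last coordinate. *)
Definition grid_lt1 : rel V := fun p q =>
  (p.1.1 < q.1.1) && ((p.1.2 < q.1.2) || (p.1.2 == q.1.2) && (p.2 == q.2)).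

(** Second order: lower row, and either a later column, or the same column and
    the same label. *)
Definition grid_lt2 : rel V := fun p q =>
  (q.1.2 < p.1.2) &&
  ((p.1.1 < q.1.1) || (p.1.1 == q.1.1) && (label p == label q)).

Lemma grid_lt1_irr : irreflexive grid_lt1.
Proof. by move=> p; rewrite /grid_lt1 ltnn. Qed.

Lemma grid_lt2_irr : irreflexive grid_lt2.
Proof. by move=> p; rewrite /grid_lt2 ltnn. Qed.

Lemma grid_lt1_trans : transitive grid_lt1.
Proof.
move=> q p r /andP[pq1 pq2] /andP[qr1 qr2]; apply/andP; split.
  exact: ltn_trans pq1 qr1.
case/orP: pq2 => [pq2|/andP[/eqP-> /eqP->] //].
case/orP: qr2 => [qr2|/andP[/eqP<- _]]; last by rewrite pq2.
by rewrite (ltn_trans pq2 qr2).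
Qed.

Lemma grid_lt2_trans : transitive grid_lt2.
Proof.
move=> q p r /andP[pq1 pq2] /andP[qr1 qr2]; apply/andP; split.
  exact: ltn_trans qr1 pq1.
case/orP: pq2 => [pq2|/andP[/eqP-> /eqP->] //].
case/orP: qr2 => [qr2|/andP[/eqP<- _]]; last by rewrite pq2.
by rewrite (ltn_trans pq2 qr2).
Qed.

(** The comparability graphs of the two orders, and their union. *)
Definition grid_graph1 := strict_graph grid_lt1_irr.
Definition grid_graph2 := strict_graph grid_lt2_irr.
Definition grid_graph : sgraph V := union_graph grid_graph1 grid_graph2.

Lemma grid_two_comparability : two_comparability grid_graph.
Proof.
exists grid_graph1, grid_graph2; split.
- exact: strict_graph_comparability grid_lt1_trans.
- exact: strict_graph_comparability grid_lt2_trans.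
split=> // -[[x y] z] [[x' y'] z'].
rewrite /= /grid_lt1 /grid_lt2 /= ![_ == x]eq_sym ![_ == y]eq_sym -!val_eqE /=.
by case: (ltngtP x x'); case: (ltngtP y y'); rewrite ?andbF ?orbF.
Qed.

Lemma grid_adj_generic p q :
  p.1.1 != q.1.1 -> p.1.2 != q.1.2 -> grid_graph p q.
Proof.
case: p q => -[x y] z [[x' y'] z'].
rewrite /= /grid_lt1 /grid_lt2 /= -!val_eqE /=.
by case: (ltngtP x x'); case: (ltngtP y y'); rewrite ?andbF ?orbF.
Qed.

Lemma grid_adj_row p q :
  p.1.1 != q.1.1 -> p.1.2 = q.1.2 -> grid_graph p q = (p.2 == q.2).
Proof.
case: p q => -[x y] z [[x' y'] z'] /= xx' <-{y'}.
rewrite /grid_lt1 /grid_lt2 /= ltnn eqxx /= !orbF [z' == z]eq_sym.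
by move: xx'; rewrite -val_eqE /=; case: (ltngtP x x'); rewrite ?orbF.
Qed.

Lemma grid_adj_col p q :
  p.1.1 = q.1.1 -> p.1.2 != q.1.2 -> grid_graph p q = (label p == label q).
Proof.
case: p q => -[x y] z [[x' y'] z'] /= <-{x'} yy'.
rewrite /grid_lt1 /grid_lt2 /= ltnn eqxx /= [_ == label (x, y, z)]eq_sym.
by move: yy'; rewrite -val_eqE /=; case: (ltngtP y y'); rewrite ?orbF.
Qed.

Lemma grid_adj_cell p q : p.1 = q.1 -> grid_graph p q = false.
Proof.
case: p q => -[x y] z [[x' y'] z'] [<- <-].
by rewrite /= /grid_lt1 /grid_lt2 /= !ltnn.
Qed.

(** Any two members share a row or a column; hence all of them lie in one row or
    all of them lie in one column. *)
Lemma grid_independent S : independent grid_graph S -> #|S| <= #|Z|.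
Proof.
move=> /independentP iS.
have share p q : p \in S -> q \in S -> p.1.1 != q.1.1 -> p.1.2 = q.1.2.
  move=> pS qS x_neq; apply/eqP/negPn/negP => y_neq.
  by have := iS p q pS qS; rewrite grid_adj_generic.
have [row|] := boolP [forall p in S, forall q in S, p.1.2 == q.1.2].
  have {}row p q : p \in S -> q \in S -> p.1.2 = q.1.2.
    by move=> pS qS; move/forall_inP/(_ p pS)/forall_inP/(_ q qS)/eqP: row.
  rewrite -(@card_in_imset _ _ (fun p : V => p.2)) ?max_card //.
  move=> p q pS qS z_eq; have y_eq := row p q pS qS.
  have x_eq : p.1.1 = q.1.1.
    apply/eqP/negPn/negP => x_neq.
    by have := iS p q pS qS; rewrite grid_adj_row // z_eq eqxx.
  by case: p q x_eq y_eq z_eq {pS qS} => -[x y] z [[x' y'] z'] /= -> -> ->.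
case/forall_inPn => p pS /forall_inPn[q qS y_neq].
have pq : p.1.1 = q.1.1.
  apply/eqP/negPn/negP => x_neq.
  by move: y_neq; rewrite (share p q pS qS x_neq) eqxx.
(* A vertex outside the column of [p] and [q] would share its row with both. *)
have col r : r \in S -> r.1.1 = p.1.1.
  move=> rS; apply/eqP/negPn/negP => x_neq.
  have rp := share r p rS pS x_neq; rewrite pq in x_neq.
  by move: y_neq; rewrite -rp (share r q rS qS x_neq) eqxx.
rewrite -(@card_in_imset _ _ label) ?max_card //.
move=> r r' rS r'S lab_eq; have x_eq : r.1.1 = r'.1.1 by rewrite !col.
have y_eq : r.1.2 = r'.1.2.
  apply/eqP/negPn/negP => y_neq'.
  by have := iS r r' rS r'S; rewrite grid_adj_col // lab_eq eqxx.
move: lab_eq; rewrite /label.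
case: r r' x_eq y_eq {rS r'S} => -[x y] z [[x' y'] z'] /= -> ->.
by move/addIr->.
Qed.

Lemma grid_clique S :
  clique grid_graph S ->
  exists fg : {ffun 'I_k -> Z} * {ffun 'I_k -> Z},
    #|S| <= #|[set c : 'I_k * 'I_k | s c == (fg.2 c.1 - fg.1 c.2)%R]|.
Proof.
move=> /cliqueP cS.
have cell_inj : {in S &, injective (fun p : V => p.1)}.
  move=> p q pS qS pq; apply/eqP/negPn/negP => p_neq.
  by have := cS p q pS qS p_neq; rewrite grid_adj_cell.
have row p q : p \in S -> q \in S -> p.1.2 = q.1.2 -> p.2 = q.2.
  move=> pS qS y_eq; have [-> //|p_neq] := eqVneq p q.
  have x_neq : p.1.1 != q.1.1.
    apply: contra_neq p_neq => x_eq; apply: cell_inj => //.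
    by case: p.1 q.1 x_eq y_eq => [x y] [x' y'] /= -> ->.
  by apply/eqP; rewrite -grid_adj_row // cS.
have col p q : p \in S -> q \in S -> p.1.1 = q.1.1 -> label p = label q.
  move=> pS qS x_eq; have [-> //|p_neq] := eqVneq p q.
  have y_neq : p.1.2 != q.1.2.
    apply: contra_neq p_neq => y_eq; apply: cell_inj => //.
    by case: p.1 q.1 x_eq y_eq => [x y] [x' y'] /= -> ->.
  by apply/eqP; rewrite -grid_adj_col // cS.
(* The value at a row or column missed by [S] is irrelevant. *)
pose f := [ffun y => if [pick p in S | p.1.2 == y] is Some p then p.2 else 0%R].
pose g :=
  [ffun x => if [pick p in S | p.1.1 == x] is Some p then label p else 0%R].
exists (f, g); rewrite -(card_in_imset cell_inj).
apply/subset_leq_card/subsetP => _ /imsetP[p pS ->].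
rewrite inE /= !ffunE.
case: pickP => [q /andP[qS /eqP x_eq]|/(_ p)]; last by rewrite pS eqxx.
case: pickP => [r /andP[rS /eqP y_eq]|/(_ p)]; last by rewrite pS eqxx.
by rewrite (col q p) // (row r p) // /label addrC addKr.
Qed.
End Grid.

(** The cliques of the grid graph are small for a suitable matrix of shifts [s],
    the targets being the matrices [g x - f y]. *)
Lemma exists_grid_graph (k K : nat) :
  0 < K -> K ^ (2 * k) * 'C(k ^ 2, K) < K ^ K ->
  exists T : finType, #|T| = k ^ 2 * K /\
    exists2 G : sgraph T, two_comparability G & hom_number G <= K.
Proof.
case: K => // K _ ltK.
have [s sP] : exists s : {ffun 'I_k * 'I_k -> 'I_K.+1},
    forall fg : {ffun 'I_k -> 'I_K.+1} * {ffun 'I_k -> 'I_K.+1},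
    #|[set c | s c == (fg.2 c.1 - fg.1 c.2)%R]| < K.+1.
  pose h (fg : {ffun 'I_k -> 'I_K.+1} * {ffun 'I_k -> 'I_K.+1})
    (c : 'I_k * 'I_k) := (fg.2 c.1 - fg.1 c.2)%R.
  apply: (exists_rarely_agreeing h); first by rewrite card_ord.
  by rewrite !card_prod !card_ffun !card_ord -expnD addnn -mul2n mulnn.
exists ('I_k * 'I_k * 'I_K.+1)%type; split.
  by rewrite !card_prod !card_ord mulnn.
exists (grid_graph s); first exact: grid_two_comparability.
apply: leq_hom_number => S /orP[/grid_clique[fg leS]|/grid_independent].
  exact: leq_trans leS (ltnW (sP fg)).
by rewrite card_ord.
Qed.

(** * Choice of the parameters *)

Local Open Scope ring_scope.

(** [K ^ K / K`!] is one of the terms of the series of [expR K]. *)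
Lemma exp_le_expR_fact (R : realType) (K : nat) :
  (K ^ K)%:R <= expR K%:R * K`!%:R :> R.
Proof.
rewrite natrX -ler_pdivrMr ?ltr0n ?fact_gt0 //.
case: K => [|K]; first by rewrite expr0 fact0 divr1 expR0.
apply: le_trans (expR_ge1Dxn K (ler0n R K.+1)).
by rewrite lerDr.
Qed.

Lemma ffact_leq_exp (n m : nat) : (n ^_ m <= n ^ m)%N.
Proof.
rewrite ffact_prod -[m in leqRHS]card_ord -prod_nat_const.
by apply: leq_prod => i _; apply: leq_subr.
Qed.

(** Logarithmic form of the condition of [exists_grid_graph], obtained from
    ['C(k ^ 2, K) <= k ^ (2 * K) / K`!] and [K`! >= (K / e) ^ K]. *)
Lemma union_bound_ln (R : realType) (k K : nat) :
  (0 < k)%N -> (0 < K)%N ->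
  (2 * k)%:R * ln K%:R + (2 * K)%:R * ln k%:R + K%:R
    < (2 * K)%:R * ln K%:R :> R ->
  (K ^ (2 * k) * 'C(k ^ 2, K) < K ^ K)%N.
Proof.
move=> k_gt0 K_gt0 lt_ln.
have pow_expR (a m : nat) : (0 < a)%N -> (a ^ m)%:R = expR (m%:R * ln a%:R) :> R.
  by move=> a_gt0; rewrite natrX expRM_natl lnK // posrE ltr0n.
have KK_gt0 : (0 < K ^ K)%N by rewrite expn_gt0 K_gt0.
rewrite -(ltn_pmul2r KK_gt0) -(ltr_nat R) -expnD addnn -mul2n.
have leC : ('C(k ^ 2, K) * K`! <= k ^ (2 * K))%N.
  by rewrite bin_ffact expnM ffact_leq_exp.
apply: (@le_lt_trans _ _ ((K ^ (2 * k) * k ^ (2 * K))%:R * expR K%:R)).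
  rewrite natrM; apply: le_trans (ler_wpM2l (ler0n _ _) (exp_le_expR_fact R K)) _.
  rewrite mulrCA mulrC -natrM ler_wpM2r ?expR_ge0 // ler_nat.
  by rewrite -mulnA leq_mul2l leC orbT.
by rewrite natrM !pow_expR // -!expRD ltr_expR.
Qed.

(** The condition of [union_bound_ln] holds for the chosen parameters, where
    [L] stands for [ln n] and [M] for [ln (ln n)].  After division by [K], the
    dominant terms are [4 * M / 3], from [2 * k * ln K / K], and [- 2 * M], from
    [2 * ln k - 2 * ln K]; the remaining terms are bounded or of order [ln M],
    and [M >= 100] suffices to absorb them. *)
Lemma parameters_ineq (R : realType) (L M t k K : R) :
  100 <= M -> L = expR M -> t = L / M ->
  0 < k -> k <= 2 * K / t -> 1 <= K -> K <= 2 * (expR (L / 3) * L) ->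
  2 * k * ln K + 2 * K * ln k + K < 2 * K * ln K.
Proof.
move=> M_ge LE tE k_gt0 le_k K_ge1 le_K.
have M_gt0 : 0 < M by lra.
have K_gt0 : 0 < K by lra.
have L_gt0 : 0 < L by rewrite LE expR_gt0.
have t_gt0 : 0 < t by rewrite tE divr_gt0.
have lnL : ln L = M by rewrite LE expRK.
have ln_t : ln t = M - ln M by rewrite tE ln_div ?posrE // lnL.
have ln2 : ln (2 : R) <= 1.
  by rewrite (_ : 2 = 1 + 1) // le_ln1Dx //; lra.
(* The tangent of [ln] at [20], with the crude bound [ln 20 <= 19]. *)
have ln_M : ln M <= M / 20 + 19.
  have -> : M = 20 * (1 + (M / 20 - 1)) by field.
  rewrite lnM ?posrE; [|lra|lra].
  have := @le_ln1Dx R (M / 20 - 1).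
  have := @le_ln1Dx R 19.
  rewrite (_ : 1 + 19 = 20 :> R); last by ring.
  move=> /(_ ltac:(lra)) ? /(_ ltac:(lra)) ?; lra.
have ln_K : ln K <= 1 + L / 3 + M.
  apply: (@le_trans _ _ (ln (2 * (expR (L / 3) * L)))).
    by rewrite ler_ln ?posrE ?mulr_gt0 ?expR_gt0 //; lra.
  rewrite !lnM ?posrE ?mulr_gt0 ?expR_gt0 // expRK lnL; lra.
have lnK_ge0 : 0 <= ln K by rewrite ln_ge0.
have ln_k : ln k <= 1 + ln K - ln t.
  apply: (@le_trans _ _ (ln (2 * K / t))).
    by rewrite ler_ln ?posrE ?divr_gt0 ?mulr_gt0.
  rewrite ln_div ?posrE ?mulr_gt0 // lnM ?posrE //; lra.
have MM_le : M * M / L <= 2.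
  rewrite ler_pdivrMr //.
  have := expR_ge1Dxn 1 (ltW M_gt0); rewrite -LE expr2 (_ : 2`!%:R = 2 :> R) //.
  lra.
have M_le : M / L <= 1.
  rewrite ler_pdivrMr // mul1r LE.
  by apply: le_trans (expR_ge1Dx M); lra.
have k_lnK : k * ln K <= K * (2 * M / 3 + 6).
  apply: (@le_trans _ _ (2 * K / t * (1 + L / 3 + M))).
    by apply: ler_pM => //; lra.
  have -> : 2 * K / t * (1 + L / 3 + M)
      = K * (2 * (M / L) + 2 * M / 3 + 2 * (M * M / L)).
    by rewrite tE; field; rewrite !gt_eqF.
  by rewrite ler_pM2l //; lra.
have K_lnk : K * ln k <= K * (1 + ln K - (M - ln M)).
  by rewrite ler_pM2l // -ln_t.
have : K * (4 * M / 3 + 12 + 2 * (1 - (M - ln M)) + 1) < 0.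
  by rewrite pmulr_rlt0 //; lra.
lra.
Qed.

Theorem theorem2 (R : realType) :
  exists N : nat, forall n : nat, (0 < n)%N -> (N <= n)%N ->
    exists G : sgraph 'I_n,
      (exists G1 G2 : sgraph 'I_n,
         [/\ comparability_graph G1, comparability_graph G2
           & edge_disjoint_union G G1 G2]) /\
      (hom_number G)%:Z =
        Num.ceil ((n%:R : R) `^ (1 / 3) *
                  (ln (n%:R : R) / ln (ln (n%:R : R))) `^ (2 / 3)).
Proof.
(* So that [ln (ln n) > 100]. *)
exists (Num.truncn (expR (expR (100 : R)))).+1 => n n_gt0 le_n.
set L := ln (n%:R : R); set M := ln L; set t := L / M; set a := _ * _.
have nR_gt0 : 0 < n%:R :> R by rewrite ltr0n.
have n_ge : expR (expR (100 : R)) < n%:R.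
  apply: lt_le_trans (_ : (Num.truncn (expR (expR (100 : R)))).+1%:R <= _).
    by have /andP[] := truncn_itv (expR_ge0 (expR (100 : R))).
  by rewrite ler_nat.
have nE : n%:R = expR L by rewrite lnK.
have L_ge : expR 100 < L by rewrite -ltr_expR -nE.
have L_gt0 : 0 < L by apply: lt_trans L_ge; rewrite expR_gt0.
have LE : L = expR M by rewrite lnK.
have M_ge : 100 < M by rewrite -ltr_expR -LE.
have M_gt0 : 0 < M by lra.
have t_gt0 : 0 < t by rewrite divr_gt0.
have ML : M <= L by rewrite LE; apply: le_trans (expR_ge1Dx M); lra.
have Ln : L <= n%:R by rewrite nE; apply: le_trans (expR_ge1Dx L); lra.
have t_ge1 : 1 <= t by rewrite ler_pdivlMr // mul1r.
have tL : t <= L by rewrite ler_pdivrMr // ler_peMr //; lra.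
have a_ge0 : 0 <= a by rewrite mulr_ge0 ?powR_ge0.
have a3 : a ^+ 3 = n%:R * t ^+ 2.
  rewrite exprMn -!powR_mulrn ?powR_ge0 // -?powRrM; try exact: ltW.
  rewrite (_ : 1 / 3 * 3%:R = 1) ?powRr1 ?ltW //; last by field.
  by rewrite (_ : 2 / 3 * 3%:R = 2%:R) ?powR_mulrn ?ltW //; field.
have cube_le (x y : R) : 0 <= x -> 0 <= y -> (x <= y) = (x ^+ 3 <= y ^+ 3).
  by move=> x_ge0 y_ge0; rewrite ler_pXn2r.
have a_le_n : a <= n%:R.
  rewrite cube_le // a3 [n%:R ^+ 3]exprS ler_pM2l // ler_pXn2r ?nnegrE ?(ltW t_gt0) //.
  exact: le_trans tL Ln.
have t_le_a : t <= a.
  rewrite cube_le ?(ltW t_gt0) // a3 [t ^+ 3]exprS ler_pM2r ?exprn_gt0 //.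
  exact: le_trans tL Ln.
have a_ge1 : 1 <= a by apply: le_trans t_le_a.
have ceil_a_ge0 : 0 <= Num.ceil a by rewrite ceil_ge0; lra.
set K := `|Num.ceil a|%N.
have KZ : K%:Z = Num.ceil a by rewrite gez0_abs.
have KR : K%:R = (Num.ceil a)%:~R :> R by rewrite -KZ.
have a_le_K : a <= K%:R by rewrite KR ceil_ge.
have K_lt : K%:R < a + 1 by rewrite KR -ltrBlDr -(intrB R _ 1) ceilB1_lt.
have K_ge1 : 1 <= K%:R :> R by apply: le_trans a_le_K.
have K_gt0 : (0 < K)%N by rewrite -(ltr0n R); lra.
have K_le_n : (K <= n)%N by rewrite -lez_nat KZ ceil_le_int.
have K_le : K%:R <= 2 * (expR (L / 3) * L).
  apply: (@le_trans _ _ (2 * a)); first lra.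
  rewrite ler_pM2l //; apply: ler_pM; rewrite ?powR_ge0 //.
    by rewrite nE -expRM mul1r.
  apply: le_trans tL; rewrite -[leRHS]powRr1 ?(ltW t_gt0) // ler_powR //; lra.
pose k := Num.truncn (2 * K%:R / t).
have Kt_ge1 : 1 <= K%:R / t by rewrite ler_pdivlMr // mul1r; lra.
have [k_le k_gt] : k%:R <= 2 * K%:R / t /\ 2 * K%:R / t < k%:R + 1.
  have /truncn_itv/andP[] : 0 <= 2 * K%:R / t by rewrite -mulrA; lra.
  by rewrite -(natr1 k) => ? ?; split.
have Kt_le : K%:R / t <= k%:R by rewrite -mulrA in k_gt; lra.
have k_gt0 : (0 < k)%N by rewrite -(ltr0n R); lra.
have n_le : (n <= k ^ 2 * K)%N.
  rewrite -(ler_nat R) natrM natrX.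
  apply: (@le_trans _ _ ((K%:R / t) ^+ 2 * K%:R)); last first.
    by rewrite ler_pM2r ?ltr0n // ler_pXn2r ?nnegrE ?ler0n //; lra.
  rewrite expr_div_n mulrAC -exprSr ler_pdivlMr ?exprn_gt0 // -a3.
  by rewrite -cube_le //; lra.
have [|T [cardT [H HH homH]]] := @exists_grid_graph k K K_gt0.
  apply: (@union_bound_ln R) => //.
  have := @parameters_ineq R L M t k%:R K%:R (ltW M_ge) LE erefl.
  by rewrite !natrM ltr0n; apply.
have n_le_T : (n <= #|T|)%N by rewrite cardT.
pose f (i : 'I_n) : T := enum_val (widen_ord n_le_T i).
have f_inj : injective f.
  by move=> i j /enum_val_inj/(congr1 val) /= ij; apply: val_inj.
have [|G GG homG] := exists_hom_number f_inj homH _ HH.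
  by rewrite card_ord.
by exists G; split; last by rewrite homG.
Qed.
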